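(* The uniform, undirected 1-neighbour knapsack problem can be solved exactly in linear time (time $O(n+m)$ for a graph with $n$ vertices and $m$ edges).
   Context: Uniform, undirected 1-neighbour knapsack problem: input is an undirected graph $G=(V,E)$ and a positive integer capacity $k$; a feasible solution is a set $U\subseteq V$ with $|U|\le k$ such that every $v\in U$ having at least one neighbour in $G$ has at least one neighbour in $U$; the objective is to maximize $|U|$. *)

(* Defs.v *)
From mathcomp Require Import all_boot.
Set Implicit Arguments.
Unset Strict Implicit.
Unset Printing Implicit Defensive.

Record sgraph (V : finType) := SGraph {
  adj : rel V;
  adj_sym : symmetric adj;
  adj_irr : irreflexive adj
}.

Definition edges (V : finType) (G : sgraph V) : {set {set V}} :=
  [set [set p.1; p.2] | p : V * V & adj G p.1 p.2].

Definition nbrs (V : finType) (G : sgraph V) (v : V) : {set V} :=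
  [set w | adj G v w].

Definition feasible (V : finType) (G : sgraph V) (k : nat) (U : {set V}) : Prop :=
  #|U| <= k /\
  forall v, v \in U -> nbrs G v != set0 -> nbrs G v :&: U != set0.

Definition optimal (V : finType) (G : sgraph V) (k : nat) (U : {set V}) : Prop :=
  feasible G k U /\ forall U', feasible G k U' -> #|U'| <= #|U|.

(* Word RAM with w-bit words.  A program is a fixed list of instructions,
   independent of w; registers and memory cells hold words, arithmetic is modulo
   2 ^ w, and each instruction costs one unit of time.  There is deliberately no
   multiplication and no bitwise operation.  The machine stops when the program
   counter leaves the program. *)
Inductive instr :=
| IConst (r c : nat)
| IAdd (r a b : nat)
| ISub (r a b : nat)
| IRead (r a : nat)
| IWrite (a b : nat)
| IOut (a : nat)
| IJeq (a b l : nat)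
| IJlt (a b l : nat).

Definition program := seq instr.

Record state := State {
  pc : nat;
  reg : nat -> nat;
  memory : nat -> nat;
  out : seq nat
}.

Definition upd (f : nat -> nat) (i x : nat) : nat -> nat :=
  fun j => if j == i then x else f j.

Definition exec (w : nat) (i : instr) (s : state) : state :=
  let: State p R M o := s in
  match i with
  | IConst r c => State p.+1 (upd R r (c %% 2 ^ w)) M o
  | IAdd r a b => State p.+1 (upd R r ((R a + R b) %% 2 ^ w)) M o
  | ISub r a b => State p.+1 (upd R r ((R a + 2 ^ w - R b) %% 2 ^ w)) M o
  | IRead r a  => State p.+1 (upd R r (M (R a))) M o
  | IWrite a b => State p.+1 R (upd M (R a) (R b)) o
  | IOut a     => State p.+1 R M (rcons o (R a))
  | IJeq a b l => State (if R a == R b then l else p.+1) R M o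
  | IJlt a b l => State (if R a < R b then l else p.+1) R M o
  end.

Definition halted (P : program) (s : state) : bool := size P <= pc s.

Definition step (w : nat) (P : program) (s : state) : state :=
  if onth P (pc s) is Some i then exec w i s else s.

Definition init (input : seq nat) : state :=
  State 0 (fun=> 0) (nth 0 input) [::].

(* On w-bit words, P started on input stops within T steps having written o. *)
Definition computes_within (w : nat) (P : program) (input : seq nat) (T : nat)
    (o : seq nat) : Prop :=
  exists t, [/\ t <= T, halted P (iter t (step w P) (init input))
              & out (iter t (step w P) (init input)) = o].

(* The lists l present G: l v enumerates the neighbours of v, in any order. *)
Definition adjacency_lists n (G : sgraph 'I_n) (l : 'I_n -> seq 'I_n) : Prop :=
  forall v, uniq (l v) /\ l v =i nbrs G v.

(* Memory layout of an instance: n, k, then n + 1 pointers, then the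
   concatenated adjacency lists.  The list of v occupies the addresses from
   (inclusive) the pointer in cell 2 + v to (exclusive) the one in cell 3 + v. *)
Definition encode n (l : 'I_n -> seq 'I_n) (k : nat) : seq nat :=
  let ls := [seq [seq val x | x <- l v] | v <- enum 'I_n] in
  n :: k :: [seq n + 3 + sumn (take i (map size ls)) | i <- iota 0 n.+1]
    ++ flatten ls.

(* Main.v *)
Require Import Defs.
From mathcomp Require Import all_boot.
From mathcomp Require Import zify.
Set Implicit Arguments.
Unset Strict Implicit.
Unset Printing Implicit Defensive.

(** Call a set supported if each of its non-isolated vertices has a neighbour in
    it.  Scan the vertices; an unchosen vertex that is isolated, or whose first
    listed neighbour is chosen, is added alone, and any other one is added
    together with its first neighbour.  The set stays supported, and would stay
    so if the last vertex added alone were removed.  Hence if one unit of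
    capacity is left when a pair is to be added, that vertex can be exchanged for
    the pair, which fills the knapsack.  The only obstruction is that no vertex
    was ever added alone.  To control it, when [2 < k] the scan starts from some
    vertex of degree at least 2 with two of its neighbours, if there is one; the
    obstruction then forces [k = 1] or maximum degree 1, so that without isolated
    vertices every supported set of size at most [k] is empty or of even size. *)

(** * Supported sets and the invariant of the greedy scan *)

Section Greedy.
Variables (V : finType) (G : sgraph V).
Implicit Types (S D U : {set V}) (s : option V).

Definition supported S : Prop :=
  forall v, v \in S -> nbrs G v != set0 -> nbrs G v :&: S != set0.

Lemma in_nbrs v w : (w \in nbrs G v) = adj G v w.
Proof. by rewrite inE. Qed.

Lemma adj_neq v w : adj G v w -> v != w.
Proof. by apply: contraTneq => ->; rewrite adj_irr. Qed.

Lemma supported0 : supported set0.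
Proof. by move=> v; rewrite inE. Qed.

Lemma supportedU1 S v :
  supported S -> nbrs G v = set0 \/ nbrs G v :&: S != set0 -> supported (v |: S).
Proof.
move=> supS vS u /setU1P[->|uS] nzu.
  case: vS => [vS|]; first by rewrite vS eqxx in nzu.
  by rewrite -!proper0 => /proper_sub_trans; apply; rewrite setIS ?subsetU1.
have := supS _ uS nzu; rewrite -!proper0 => /proper_sub_trans; apply.
by rewrite setIS ?subsetU1.
Qed.

Lemma supportedU2 S v w :
  supported S -> adj G v w -> supported (v |: (w |: S)).
Proof.
move=> supS vw u.
rewrite !inE => /or3P[/eqP->|/eqP->|uS] nzu; apply/set0Pn.
- by exists w; rewrite !inE vw eqxx orbT.
- by exists v; rewrite !inE adj_sym vw eqxx.
- have /set0Pn[x] := supS _ uS nzu.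
  by rewrite !inE => /andP[ux xS]; exists x; rewrite !inE ux xS !orbT.
Qed.

Lemma cardsU2 S v w :
  v \notin S -> w \notin S -> v != w -> #|v |: (w |: S)| = #|S|.+2.
Proof. by move=> vS wS vw; rewrite !cardsU1 !inE !negb_or vw vS wS. Qed.

(* [D] is the set of vertices examined so far; [s] is the vertex that was added
   last on its own, and hence is not the only neighbour of a chosen vertex. *)
Record greedy_inv k D S s : Prop := GreedyInv {
  greedy_card : #|S| <= k;
  greedy_supported : supported S;
  greedy_single : if s is Some x then x \in S /\ supported (S :\ x) else
    [/\ ~~ odd #|S|, forall v, v \in D :|: S -> nbrs G v != set0
      & 2 < k -> forall v, #|nbrs G v| <= 1];
  greedy_cover :
    [\/ #|S| = k, D \subset S | s = None /\ #|S|.+1 = k]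
}.

Lemma greedy_init k :
  (2 < k -> forall v, #|nbrs G v| <= 1) -> greedy_inv k set0 set0 None.
Proof.
move=> deg1; split; rewrite ?cards0 //; first exact: supported0.
  by split=> // v; rewrite !inE.
by constructor 2; rewrite sub0set.
Qed.

(** Removing [b] leaves [v] and [a], which support each other, so a vertex available for exchange
    exists from the outset. The examined set stays empty: the scan meets the three vertices again as
    chosen ones. *)
Lemma greedy_seed k v a b :
  2 < k -> adj G v a -> adj G v b -> a != b ->
  #|b |: (a |: (v |: set0))| = 3 /\
  greedy_inv k set0 (b |: (a |: (v |: set0))) (Some b).
Proof.
move=> k2 va vb ab.
have neva := adj_neq va; have nevb := adj_neq vb.
have c3 : #|b |: (a |: (v |: set0))| = 3.
  rewrite !cardsU1 !inE cards0 (eq_sym b v) (eq_sym b a) (eq_sym a v).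
  by rewrite (negPf neva) (negPf nevb) (negPf ab).
have sav : supported (a |: (v |: set0)).
  by apply: supportedU2; [exact: supported0 | rewrite adj_sym].
split=> //; split; first by rewrite c3.
- apply: supportedU1 => //; right; apply/set0Pn; exists v.
  by rewrite !inE adj_sym vb eqxx !orbT.
- split; first by rewrite !inE eqxx.
  rewrite setU1K // !inE (eq_sym b v) (eq_sym b a).
  by rewrite (negPf nevb) (negPf ab).
- by constructor 2; rewrite sub0set.
Qed.

Lemma greedy_marked k D S s v :
  greedy_inv k D S s -> v \in S -> greedy_inv k (v |: D) S s.
Proof.
case=> cS sS Ss cov vS; split=> //.
  case: s Ss {cov} => // [[oS nzD deg1]]; split=> // u.
  by rewrite -setUA => /setU1P[->|]; apply: nzD; rewrite // inE vS orbT.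
case: cov => [?|DS|?]; [by constructor 1 | constructor 2 | by constructor 3].
by rewrite subUset sub1set vS.
Qed.

(** The old [s] can be forgotten, since deleting [v] gives back the supported set [S]. If exactly
    one unit was free, the knapsack is now full. *)
Lemma greedy_add1 k D S s v :
  greedy_inv k D S s -> #|S| < k -> v \notin S ->
  nbrs G v = set0 \/ nbrs G v :&: S != set0 ->
  greedy_inv k (v |: D) (v |: S) (Some v).
Proof.
case=> cS sS Ss cov ltSk vS nv; have cvS : #|v |: S| = #|S|.+1 by rewrite cardsU1 vS.
split; rewrite ?cvS //.
- exact: supportedU1.
- by split; rewrite ?setU11 ?setU1K.
- case: cov => [eS|DS|[_ eS]]; [lia | | by constructor 1].
  by constructor 2; rewrite setUS.
Qed.

(** Removing the vertex held in [s] commutes with adding the pair, so it stays removable; if there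
    is none, the parity of [#|S|] is kept. *)
Lemma greedy_add2 k D S s v w :
  greedy_inv k D S s -> #|S|.+1 < k -> v \notin S -> w \notin S -> adj G v w ->
  greedy_inv k (v |: D) (v |: (w |: S)) s.
Proof.
case=> cS sS Ss cov ltSk vS wS vw.
have cvS := cardsU2 vS wS (adj_neq vw).
split; rewrite ?cvS //.
- exact: supportedU2.
- case: s Ss {cov} => [x [xS sx]|[oS nzD deg1]].
    have nx y : y \notin S -> x != y by apply: contraNneq => <-.
    split; first by rewrite !inE xS !orbT.
    suff -> : (v |: (w |: S)) :\ x = v |: (w |: (S :\ x)) by exact: supportedU2.
    apply/setP=> y; rewrite !inE.
    case: (eqVneq y x) => //= ->.
    by rewrite (negPf (nx _ vS)) (negPf (nx _ wS)).
  split=> //; first by rewrite /= negbK.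
  move=> u; rewrite !inE => uDS.
  have [->|uv] := eqVneq u v; first by apply/set0Pn; exists w; rewrite in_nbrs.
  have [->|uw] := eqVneq u w.
    by apply/set0Pn; exists v; rewrite in_nbrs adj_sym.
  by apply: nzD; move: uDS; rewrite inE (negPf uv) (negPf uw).
- case: cov => [eS|DS|[_ eS]]; [lia | | lia].
  by constructor 2; rewrite setUS // (subset_trans DS) ?subsetU1.
Qed.

(** Losing [x] and gaining two new vertices uses the last unit, and a full knapsack is optimal. *)
Lemma greedy_swap k D S x v w :
  greedy_inv k D S (Some x) -> #|S|.+1 = k -> v \notin S -> w \notin S ->
  adj G v w -> optimal G k (v |: (w |: (S :\ x))).
Proof.
case=> cS sS [xS sx] _ eS vS wS vw.
have -> : k = #|v |: (w |: (S :\ x))|.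
  rewrite cardsU2 ?(adj_neq vw) // ?in_setD1 ?(negPf vS) ?(negPf wS) ?andbF //.
  by rewrite -eS (cardsD1 x) xS.
split; last by move=> U [].
by split=> //; apply: supportedU2.
Qed.

(** With nothing to exchange, the scan goes on with one free unit, which a later single vertex may
    still take; [w] witnesses that [v] is not isolated. *)
Lemma greedy_skip k D S v w :
  greedy_inv k D S None -> #|S|.+1 = k -> adj G v w -> greedy_inv k (v |: D) S None.
Proof.
case=> cS sS [oS nzD deg1] cov eS vw; split=> //; last by constructor 3.
split=> // u; rewrite -setUA => /setU1P[->|]; last exact: nzD.
by apply/set0Pn; exists w; rewrite in_nbrs.
Qed.

(** The set splits into pairs: [v] and its only neighbour [w] both lie in [U], and no other vertex
    is adjacent to either, so removing both leaves a supported set. *)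
Lemma matching_even U :
  (forall v, #|nbrs G v| <= 1) -> (forall v, v \in U -> nbrs G v != set0) ->
  supported U -> ~~ odd #|U|.
Proof.
move=> deg1; have [m] := ubnP #|U|; elim: m U => // m IH U leUm nz sU.
have [->|[v vU]] := set_0Vmem U; first by rewrite cards0.
have /set0Pn[w] := sU _ vU (nz _ vU); rewrite !inE => /andP[vw wU].
have UE : U = v |: (w |: (U :\ v :\ w)).
  by rewrite setD1K ?setD1K // !inE wU eq_sym (adj_neq vw).
have cU : #|U| = #|U :\ v :\ w|.+2.
  by rewrite {1}UE cardsU2 ?(adj_neq vw) // !inE eqxx ?andbF.
have uniq_nbr x y z : adj G x y -> adj G x z -> y = z.
  move=> xy xz; have /card_le1_eqP := deg1 x.
  by move=> /(_ z y); apply; rewrite in_nbrs.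
rewrite cU /= negbK; apply: IH; first by lia.
  by move=> u; rewrite !inE => /and3P[_ _]; apply: nz.
move=> u; rewrite !inE => /and3P[uw uv uU] nzu.
have /set0Pn[x] := sU _ uU nzu; rewrite !inE => /andP[ux xU].
apply/set0Pn; exists x; rewrite !inE ux xU andbT /=; apply/andP; split.
  apply: contraNneq uv => xw; rewrite xw adj_sym in ux.
  by rewrite (uniq_nbr w u v) // adj_sym.
apply: contraNneq uw => xv; rewrite xv adj_sym in ux.
by rewrite (uniq_nbr v u w).
Qed.

(** The delicate case is [#|S|.+1 = k] with [#|S|] even and no isolated vertex: a better [U] would
    have odd size [k]. For [2 < k] this contradicts [matching_even]; otherwise [U] is a singleton,
    whose vertex would have to be its own neighbour. *)
Lemma greedy_optimal k D S s :
  greedy_inv k D S s -> #|S| = k \/ D = setT -> optimal G k S.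
Proof.
case=> cS sS Ss cov fin; split=> // U [cU sU].
have [eS|neS] := eqVneq #|S| k; first by rewrite eS.
case: fin => [/eqP|DT]; first by rewrite (negPf neS).
case: cov => [/eqP|DS|[s0 eS]]; first by rewrite (negPf neS).
  by move: DS; rewrite DT subTset => /eqP ->; rewrite subset_leq_card ?subsetT.
move: Ss; rewrite {}s0 {}DT => -[oS nz deg1].
have {}nz v : nbrs G v != set0 by apply: nz; rewrite !inE.
rewrite -ltnS eS ltn_neqAle cU andbT; apply/eqP => eU.
have oU : odd #|U| by rewrite eU -eS /= oS.
have [k2|k2] := ltnP 2 k.
  by have := matching_even (deg1 k2) (fun v _ => nz v) sU; rewrite oU.
have /eqP/cards1P[u Uu] : #|U| = 1 by case: #|U| eU oU => [|[|[|]]] //; lia.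
have /set0Pn[x] : nbrs G u :&: U != set0 by apply: sU => //; rewrite Uu inE.
by rewrite Uu !inE => /andP[ux /eqP xu]; rewrite xu adj_irr in ux.
Qed.
End Greedy.

(** The left side counts ordered adjacent pairs, and at most two of them share an underlying edge.
    This bounds the total length of the adjacency lists. *)
Lemma sum_degrees_le (V : finType) (G : sgraph V) :
  \sum_v #|nbrs G v| <= 2 * #|edges G|.
Proof.
have -> : \sum_v #|nbrs G v| = \sum_(p : V * V | adj G p.1 p.2) 1.
  rewrite (eq_bigr (fun v => \sum_(w | adj G v w) 1)).
    by rewrite pair_big_dep.
  by move=> v _; rewrite -sum1_card; apply: eq_bigl => w; rewrite inE.
rewrite (partition_big (fun p => [set p.1; p.2]) (mem (edges G))) /=; last first.
  by move=> p pG; apply/imsetP; exists p; rewrite ?inE.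
rewrite mulnC -sum_nat_const; apply: leq_sum => _ /imsetP[[a b] _ ->] /=.
rewrite sum1_card (leq_trans (n := #|[set (a, b); (b, a)]|)) //; last first.
  by rewrite cards2; case: eqP.
apply: subset_leq_card; apply/subsetP=> -[c d]; rewrite !inE /= => /andP[_ /eqP E].
have cab : c \in [set a; b] by rewrite -E set21.
have dab : d \in [set a; b] by rewrite -E set22.
have acd : a \in [set c; d] by rewrite E set21.
have bcd : b \in [set c; d] by rewrite E set22.
move: cab dab acd bcd; rewrite !inE !xpair_eqE.
by move=> /orP[]/eqP-> /orP[]/eqP->; rewrite !eqxx ?(eq_sym b); case: (a == b).
Qed.

(** * Time-bounded execution of a machine program *)

Section Running.
Variables (w : nat) (P : program).

(** Since [T] is only an upper bound, branches of different lengths can share one budget. *)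
Definition within (T : nat) (s : state) (Q : state -> Prop) : Prop :=
  exists2 t, t <= T & Q (iter t (step w P) s).

Lemma within_now T s (Q : state -> Prop) : Q s -> within T s Q.
Proof. by exists 0. Qed.

Lemma within_step T s Q : within T (step w P s) Q -> within T.+1 s Q.
Proof. by case=> t tT q; exists t.+1; rewrite ?iterSr. Qed.

Lemma within_bind T1 T2 s (Q1 Q2 : state -> Prop) :
  within T1 s Q1 -> (forall s', Q1 s' -> within T2 s' Q2) ->
  within (T1 + T2) s Q2.
Proof.
move=> [t1 le1 q1] /(_ _ q1)[t2 le2 q2].
by exists (t2 + t1); rewrite ?iterD ?(addnC T1) ?leq_add.
Qed.

Lemma within_leq T1 T2 s Q : T1 <= T2 -> within T1 s Q -> within T2 s Q.
Proof. by move=> le12 [t tT1 q]; exists t; rewrite ?(leq_trans tT1). Qed.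

Lemma within_imp T1 T2 s (Q1 Q2 : state -> Prop) :
  T1 <= T2 -> within T1 s Q1 -> (forall s', Q1 s' -> Q2 s') -> within T2 s Q2.
Proof.
by move=> le12 [t tT1 q] imp; exists t; [rewrite (leq_trans tT1) | apply: imp].
Qed.

(** The disjunction lets any round leave the loop early, with [Q] already established. *)
Lemma within_loop c T m (I : nat -> state -> Prop) (Q : state -> Prop) :
  (forall i s, i < m -> I i s -> within c s (fun s' => I i.+1 s' \/ Q s')) ->
  (forall s, I m s -> within T s Q) ->
  forall s, I 0 s -> within (c * m + T) s Q.
Proof.
move=> body exit.
(* Here [d] is the number of rounds left. *)
suff loop d i s : m = i + d -> I i s -> within (c * d + T) s Q by move=> s; apply: loop.
elim: d i s => [|d IH] i s mE Ii.
  by rewrite muln0; apply: exit; rewrite mE addn0.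
have lt_im : i < m by lia.
rewrite mulnS -addnA; apply: within_bind (body _ _ lt_im Ii) _.
move=> s' [Is'|q]; last exact: within_now.
by apply: IH Is'; lia.
Qed.
End Running.

(** * Addresses in the encoded instance *)

Section Layout.
Variables (n : nat) (l : 'I_n -> seq 'I_n) (k : nat).

Definition degs : seq nat := [seq size (l v) | v <- enum 'I_n].
(** The offset skips [n], [k] and the [n.+1] pointers; [ptr n] is the first address past the
    input. *)
Definition ptr (i : nat) : nat := n + 3 + sumn (take i degs).

Lemma size_degs : size degs = n.
Proof. by rewrite size_map size_enum_ord. Qed.

Lemma nth_degs (v : 'I_n) : nth 0 degs v = size (l v).
Proof. by rewrite (nth_map v) ?size_enum_ord // nth_ord_enum. Qed.

Lemma ptrS (v : 'I_n) : ptr v.+1 = ptr v + size (l v).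
Proof.
by rewrite /ptr (take_nth 0) ?size_degs // sumn_rcons nth_degs addnA.
Qed.

Lemma ptr_mono i j : i <= j -> ptr i <= ptr j.
Proof.
move=> /subnK <-; elim: (j - i) => // d /leq_trans; apply; rewrite addSn.
have [lt_n|ge_n] := ltnP (d + i) n; first by rewrite (ptrS (Ordinal lt_n)) leq_addr.
by rewrite /ptr !take_oversize ?size_degs // ltnW.
Qed.

Lemma sumn_degs : sumn degs = \sum_v size (l v).
Proof. by rewrite sumnE big_map big_enum. Qed.

Definition lists := [seq [seq val x | x <- l v] | v <- enum 'I_n].

Lemma shape_lists : map size lists = degs.
Proof. by rewrite -map_comp; apply: eq_map => v /=; rewrite size_map. Qed.

Lemma encodeE : encode l k =
  n :: k :: [seq ptr i | i <- iota 0 n.+1] ++ flatten lists.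
Proof. by rewrite /encode -/lists shape_lists. Qed.

Lemma size_encode : size (encode l k) = ptr n.
Proof.
rewrite encodeE /= size_cat size_map size_iota size_flatten /shape shape_lists /ptr.
by rewrite take_oversize ?size_degs //; lia.
Qed.

Lemma nth_encode_ptr i : i <= n -> nth 0 (encode l k) (2 + i) = ptr i.
Proof.
move=> le_in; rewrite encodeE /= -[in LHS]cat_cons.
rewrite nth_cat /= size_map size_iota ltnS le_in.
by rewrite -(map_cons ptr) -/(iota 0 n.+1) (nth_map 0) ?size_iota ?nth_iota.
Qed.

Lemma nth_encode_list (v : 'I_n) j :
  j < size (l v) -> nth 0 (encode l k) (ptr v + j) = nth v (l v) j.
Proof.
(* The address is split into the header of [n + 3] cells and a position in the flattened lists;
   [.+2] exposes the cells of [n] and [k]. *)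
move=> lt_j; have -> : ptr v + j = (n.+1 + flatten_index degs v j).+2.
  by rewrite /ptr /flatten_index; lia.
rewrite encodeE; set s := map ptr _.
have <- : size s = n.+1 by rewrite size_map size_iota.
rewrite /= nth_cat ltnNge leq_addr /= addKn -shape_lists nth_flatten.
have lt_j' : j < nth 0 (shape lists) v by rewrite /shape shape_lists nth_degs.
rewrite flatten_indexKl // flatten_indexKr // (nth_map v) ?size_enum_ord //.
by rewrite nth_ord_enum (nth_map v).
Qed.
End Layout.

(* Registers: 0, 1, 2 hold the constants 0, 1, 2; 3 holds n; 4 the remaining
   capacity; 5 the first address after the input, where the marks of the chosen
   vertices are kept; 6 the address of the mark of the last vertex chosen on its
   own, or 0; 7 the loop counter; the others are scratch. *)
Definition knapsack : program :=
  [:: (*  0 *) IConst 1 1; IConst 2 2; IRead 3 0; IRead 4 1; IAdd 5 3 2;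
      (*  5 *) IRead 5 5; IJlt 2 4 8; IJeq 0 0 28;
      (*  8: look for a vertex of degree at least 2 *)
      IJeq 7 3 28; IAdd 8 7 2; IRead 9 8; IAdd 8 8 1; IRead 10 8;
      (* 13 *) ISub 10 10 9; IJlt 1 10 17; IAdd 7 7 1; IJeq 0 0 8;
      (* 17: choose it with two of its neighbours *)
      IRead 10 9; IAdd 9 9 1; IRead 11 9; IAdd 12 5 7; IWrite 12 1;
      (* 22 *) IAdd 12 5 10; IWrite 12 1; IAdd 6 5 11; IWrite 6 1;
      (* 26 *) ISub 4 4 2; ISub 4 4 1;
      (* 28: greedy scan *)
      IConst 7 0; IJeq 7 3 59; IJeq 4 0 59; IAdd 8 5 7; IRead 9 8;
      (* 33 *) IJeq 9 1 57; IAdd 10 7 2; IRead 11 10; IAdd 10 10 1; IRead 12 10;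
      (* 38 *) IJeq 11 12 54; IRead 10 11; IAdd 10 5 10; IRead 11 10;
      (* 42 *) IJeq 11 1 54; IJeq 4 1 48;
      (* 44: choose a pair *)
      IWrite 8 1; IWrite 10 1; ISub 4 4 2; IJeq 0 0 57;
      (* 48: swap a single vertex for a pair *)
      IJeq 6 0 57; IWrite 6 0; IWrite 8 1; IWrite 10 1; ISub 4 4 1; IJeq 0 0 59;
      (* 54: choose a single vertex *)
      IWrite 8 1; IAdd 6 8 0; ISub 4 4 1;
      (* 57 *) IAdd 7 7 1; IJeq 0 0 29;
      (* 59: print the marked vertices *)
      IConst 7 0; IJeq 7 3 67; IAdd 8 5 7; IRead 9 8; IJeq 9 0 65; IOut 7;
      (* 65 *) IAdd 7 7 1; IJeq 0 0 60].

(** * Execution of the program on an encoded instance *)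

Section Knapsack.
Variables (n : nat) (G : sgraph 'I_n) (l : 'I_n -> seq 'I_n) (k w : nat).
Hypothesis l_adj : adjacency_lists G l.
Hypothesis k_fits : k < 2 ^ w.

Let base := ptr l n.
(** Ensures that no address computation wraps around. *)
Hypothesis memory_fits : base + n < 2 ^ w.

Notation run := (within w knapsack).

Definition consts (R : nat -> nat) : Prop :=
  [/\ R 0 = 0, R 1 = 1, R 2 = 2, R 3 = n & R 5 = base].

(** The input must survive the writing of marks, because the lists are still read afterwards. A mark
    is a boolean coerced to 0 or 1. *)
Definition marks (M : nat -> nat) (S : {set 'I_n}) : Prop :=
  (forall a, a < base -> M a = nth 0 (encode l k) a) /\
  (forall v : 'I_n, M (base + v) = (v \in S)).

(** The value 0 can stand for [None] because [base] is at least 3. *)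
Definition mark_address (s : option 'I_n) : nat := if s is Some x then base + x else 0.

Definition below (i : nat) : {set 'I_n} := [set v : 'I_n | v < i].

Definition choice_state (c : nat) (S : {set 'I_n}) s (st : state) : Prop :=
  exists R M, [/\ st = State c R M [::], consts R, marks M S,
                  R 4 = k - #|S| & R 6 = mark_address s].

Lemma base_ge3 : n + 3 <= base.
Proof. by rewrite /base /ptr leq_addr. Qed.

(** Cells past the input hold the default 0 of [nth], so the marks need no initialising pass. *)
Lemma marks0 : marks (nth 0 (encode l k)) set0.
Proof.
by split=> // v; rewrite inE nth_default ?size_encode ?leq_addr.
Qed.

Lemma marksU1 M S (v : 'I_n) : marks M S -> marks (upd M (base + v) 1) (v |: S).
Proof.
case=> inp mk; split=> [a lt_a|u]; rewrite /upd.
  by rewrite inp //; case: eqP => //; lia.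
by rewrite eqn_add2l !inE mk -val_eqE; case: eqP.
Qed.

Lemma marksD1 M S (v : 'I_n) : marks M S -> marks (upd M (base + v) 0) (S :\ v).
Proof.
case=> inp mk; split=> [a lt_a|u]; rewrite /upd.
  by rewrite inp //; case: eqP => //; lia.
by rewrite eqn_add2l !inE mk -val_eqE; case: eqP.
Qed.

Lemma marks_ptr M S i : marks M S -> i <= n -> M (2 + i) = ptr l i.
Proof.
case=> inp _ le_in; rewrite inp ?nth_encode_ptr //.
by have := base_ge3; lia.
Qed.

Lemma marks_list M S (v : 'I_n) j :
  marks M S -> j < size (l v) -> M (ptr l v + j) = nth v (l v) j.
Proof.
case=> inp _ lt_j; rewrite inp ?nth_encode_list //.
by have := ptr_mono l (ltn_ord v); rewrite ptrS -/base; lia.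
Qed.

Lemma size_nbrs v : size (l v) = #|nbrs G v|.
Proof.
by have [u e] := l_adj v; rewrite -(eq_card e); apply/esym/card_uniqP.
Qed.

Lemma below0 : below 0 = set0.
Proof. by apply/setP=> v; rewrite !inE. Qed.

Lemma belowS (v : 'I_n) : below v.+1 = v |: below v.
Proof. by apply/setP=> u; rewrite !inE ltnS leq_eqVlt -val_eqE. Qed.

Lemma below_all : below n = setT.
Proof. by apply/setP=> v; rewrite !inE ltn_ord. Qed.

Lemma add_small a b : a + b < 2 ^ w -> (a + b) %% 2 ^ w = a + b.
Proof. exact: modn_small. Qed.

Lemma sub_small a b : b <= a -> a < 2 ^ w -> (a + 2 ^ w - b) %% 2 ^ w = a - b.
Proof.
by move=> le_ba lt_a; rewrite addnC -addnBA // modnDl modn_small //; lia.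
Qed.

Lemma updE f i x j : upd f i x j = if j == i then x else f j.
Proof. by []. Qed.

Ltac tick := apply: within_step; rewrite /step /= ?updE /=.

Definition seed_inv (i : nat) (st : state) : Prop :=
  [/\ 2 < k, forall v, v \in below i -> #|nbrs G v| <= 1 &
  exists R M, [/\ st = State 8 R M [::], consts R, marks M set0, R 4 = k
                & R 6 = 0 /\ R 7 = i]].

Definition seeded (st : state) : Prop :=
  exists S s, greedy_inv G k set0 S s /\ choice_state 28 S s st.

Lemma seed_body i st :
  i < n -> seed_inv i st -> run 20 st (fun st' => seed_inv i.+1 st' \/ seeded st').
Proof.
move=> lt_in [k2 deg1 [R [M [-> [R0 R1 R2 R3 R5] mk R4 [R6 R7]]]]].
have b3 := base_ge3.
have [v iE] : exists v : 'I_n, i = v by exists (Ordinal lt_in).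
rewrite {i}iE in lt_in deg1 R7 *.
have le_ptr := ptr_mono l (ltn_ord v); have ptrSv := ptrS l v.
rewrite -/base in le_ptr.
tick; rewrite R7 R3 (ltn_eqF lt_in).
tick; rewrite R7 R2 add_small; last by lia.
tick; rewrite (addnC _ 2) (marks_ptr mk) 1?ltnW //.
tick; rewrite R1 add_small; last by lia.
tick; rewrite -(addnA 2) addn1 (marks_ptr mk) //.
tick; rewrite sub_small; try lia.
(* The difference of two consecutive pointers is the degree of [v]. *)
tick; rewrite R1 ptrSv addKn; case: ltnP => deg_v; last first.
  tick; rewrite R7 R1 add_small; last by lia.
  tick; rewrite R0 /=; apply: within_now; left; split=> //.
    by move=> u; rewrite belowS => /setU1P[->|/deg1 //]; rewrite -size_nbrs.
  by eexists; exists M; split; [by [] | by split | by [] | by [] | rewrite /= addn1].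
have [u_l l_nbrs] := l_adj v.
have va : adj G v (nth v (l v) 0) by rewrite -in_nbrs -l_nbrs mem_nth // ltnW.
have vb : adj G v (nth v (l v) 1) by rewrite -in_nbrs -l_nbrs mem_nth.
have ab : nth v (l v) 0 != nth v (l v) 1 by rewrite nth_uniq // ltnW.
have [cS inv] := greedy_seed k2 va vb ab.
have lt_a := ltn_ord (nth v (l v) 0); have lt_b := ltn_ord (nth v (l v) 1).
tick; rewrite -[in M _](addn0 (ptr l v)) (marks_list mk) 1?ltnW //.
tick; rewrite R1 add_small; last by lia.
tick; rewrite (marks_list mk) //.
tick; rewrite R5 R7 add_small; last by lia.
tick; rewrite R1.
tick; rewrite R5 add_small; last by lia.
tick; rewrite R1.
tick; rewrite R5 add_small; last by lia.
tick; rewrite R1.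
tick; rewrite R4 R2 sub_small ?(ltnW k2) //.
tick; rewrite R1 sub_small; try lia.
apply: within_now; right; eexists; exists (Some (nth v (l v) 1)); split; first exact: inv.
eexists; eexists; split; [by [] | by split | | by rewrite cS /= -subnDA | by []].
by do 3!apply: marksU1.
Qed.

Definition scan_inv (i : nat) (st : state) : Prop :=
  exists S s R M, [/\ greedy_inv G k (below i) S s, st = State 29 R M [::],
     consts R, marks M S & [/\ R 4 = k - #|S|, R 6 = mark_address s & R 7 = i]].

Definition chosen (st : state) : Prop :=
  exists S R M, [/\ optimal G k S, st = State 59 R M [::], consts R & marks M S].

Lemma scan_next (v : 'I_n) S s R M :
  greedy_inv G k (v |: below v) S s -> consts R -> marks M S ->
  R 4 = k - #|S| -> R 6 = mark_address s -> R 7 = v ->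
  run 2 (State 57 R M [::]) (scan_inv v.+1).
Proof.
move=> inv [R0 R1 R2 R3 R5] mk R4 R6 R7; have b3 := base_ge3; have lt_v := ltn_ord v.
tick; rewrite R7 R1 add_small; last by lia.
tick; rewrite R0 /=; apply: within_now; exists S, s; eexists; exists M.
by split; [rewrite belowS | by [] | by split | by [] | rewrite /= addn1].
Qed.

(** Common tail of two branches: [v] is isolated, or its first listed neighbour is already
    chosen. *)
Lemma scan_single (v : 'I_n) S s R M :
  greedy_inv G k (below v) S s -> #|S| < k -> v \notin S ->
  nbrs G v = set0 \/ nbrs G v :&: S != set0 ->
  consts R -> marks M S ->
  R 4 = k - #|S| -> R 7 = v -> R 8 = base + v ->
  run 5 (State 54 R M [::]) (scan_inv v.+1).
Proof.
move=> inv ltSk vS nv [R0 R1 R2 R3 R5] mk R4 R7 R8; have lt_v := ltn_ord v.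
tick; rewrite R8 R1.
tick; rewrite R8 R0 add_small ?addn0; last by lia.
tick; rewrite R4 R1 sub_small; try lia.
apply: (scan_next (greedy_add1 inv ltSk vS nv)); rewrite //=.
  exact: marksU1.
by rewrite updE cardsU1 vS /=; lia.
Qed.

Lemma scan_body i st :
  i < n -> scan_inv i st -> run 30 st (fun st' => scan_inv i.+1 st' \/ chosen st').
Proof.
move=> lt_in [S [s [R [M [inv -> cR mk [R4 R6 R7]]]]]].
have [R0 R1 R2 R3 R5] := cR.
have b3 := base_ge3.
have [v iE] : exists v : 'I_n, i = v by exists (Ordinal lt_in).
rewrite {i}iE in lt_in inv R7 *.
have le_ptr := ptr_mono l (ltn_ord v); have ptrSv := ptrS l v.
rewrite -/base in le_ptr.
have cS := greedy_card inv.
have mkv := mk.2 v.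
tick; rewrite R7 R3 (ltn_eqF lt_in).
tick; rewrite R4 R0; case: eqP => [full|nfull].
  apply: within_now; right; exists S, R, M; split=> //.
  by apply: (greedy_optimal inv); left; lia.
have ltSk : #|S| < k by lia.
tick; rewrite R5 R7 add_small; last by lia.
tick; rewrite mkv.
tick; rewrite R1 eqb1; case: (boolP (v \in S)) => vS /=.
  apply: within_imp _ (scan_next (greedy_marked inv vS) _ mk _ _ _) _;
    rewrite ?updE //=; last by left.
tick; rewrite R7 R2 add_small; last by lia.
tick; rewrite (addnC _ 2) (marks_ptr mk) 1?ltnW //.
tick; rewrite R1 add_small; last by lia.
tick; rewrite -(addnA 2) addn1 (marks_ptr mk) //.
(* Equal consecutive pointers mean an empty list, hence an isolated vertex. *)
tick; rewrite ptrSv -[X in X == _]addn0 eqn_add2l eq_sym size_nbrs.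
rewrite cards_eq0; case: eqP => [iso|/eqP niso].
  apply: within_imp _ (scan_single inv ltSk vS (or_introl iso) _ mk _ _ _) _;
    rewrite ?updE //=; last by left.
have deg_v : 0 < size (l v) by rewrite size_nbrs card_gt0.
(* Only this one neighbour is inspected, so a round takes constant time whatever the degree. *)
set u := nth v (l v) 0; have lt_u := ltn_ord u.
have vu : adj G v u by rewrite -in_nbrs -(l_adj v).2 mem_nth.
tick; rewrite -[in M _](addn0 (ptr l v)) (marks_list mk) -/u //.
tick; rewrite R5 add_small; last by lia.
tick; rewrite mk.2.
tick; rewrite R1 eqb1; case: (boolP (u \in S)) => uS /=.
  have nv : nbrs G v :&: S != set0 by apply/set0Pn; exists u; rewrite inE in_nbrs vu.
  apply: within_imp _ (scan_single inv ltSk vS (or_intror nv) _ mk _ _ _) _;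
    rewrite ?updE //=; last by left.
tick; rewrite R4 R1; case: eqP => rem1; last first.
  have ltSSk : #|S|.+1 < k by lia.
  tick; rewrite R1.
  tick; rewrite R1.
  tick; rewrite R4 R2 sub_small; try lia.
  tick; rewrite R0 /=.
  apply: within_imp _ (scan_next (greedy_add2 inv ltSSk vS uS vu) _ _ _ _ _) _;
    rewrite ?updE //=; last by left.
  - by rewrite setUCA; do 2!apply: marksU1.
  - by rewrite cardsU2 ?(adj_neq vu) //=; lia.
have eS : #|S|.+1 = k by lia.
(* One unit is left for a pair: register 6 tells whether a single vertex can be exchanged. *)
tick; rewrite R6 R0; case: s inv R6 => [x|] inv R6 /=; last first.
  apply: within_imp _ (scan_next (greedy_skip inv eS vu) _ mk _ _ _) _;
    rewrite ?updE //=; last by left.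
rewrite (_ : (base + x == 0) = false); last by lia.
tick; rewrite R6 R0.
tick; rewrite R1.
tick; rewrite R1.
tick; rewrite R4 R1 sub_small; try lia.
tick; rewrite R0 /=.
apply: within_now; right; eexists; eexists; eexists.
split; [exact: (greedy_swap inv eS vS uS vu) | by [] | by split |].
by rewrite setUCA; do 2!apply: marksU1; apply: marksD1.
Qed.

(** Filtering [iota] by the marks lets a round extend the output at its end; [enum S] appears only
    on exit. *)
Definition print_inv (S : {set 'I_n}) (i : nat) (st : state) : Prop :=
  exists R M, [/\ st = State 60 R M [seq j <- iota 0 i | M (base + j) == 1],
     consts R, marks M S & R 7 = i].

Definition printed (S : {set 'I_n}) (st : state) : Prop :=
  halted knapsack st /\ out st = [seq val v | v <- enum S].

Lemma print_body S i st :
  i < n -> print_inv S i st ->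
  run 7 st (fun st' => print_inv S i.+1 st' \/ printed S st').
Proof.
move=> lt_in [R [M [-> [R0 R1 R2 R3 R5] mk R7]]].
have Mi := mk.2 (Ordinal lt_in); rewrite /= in Mi.
have outE : [seq j <- iota 0 i.+1 | M (base + j) == 1] =
       let o := [seq j <- iota 0 i | M (base + j) == 1] in
       if Ordinal lt_in \in S then rcons o i else o.
  by rewrite -(addn1 i) iotaD cats1 filter_rcons Mi eqb1.
tick; rewrite R7 R3 (ltn_eqF lt_in).
tick; rewrite R5 R7 add_small; last by lia.
tick.
tick; rewrite R0 Mi; move: outE; case: (_ \in S) => /= outE.
  tick; rewrite R7 -outE.
  tick; rewrite R7 R1 add_small; last by lia.
  tick; rewrite R0 /=; apply: within_now; left; eexists; exists M.
  by split; [by [] | by split | by [] | rewrite /= addn1].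
tick; rewrite R7 R1 -outE add_small; last by lia.
tick; rewrite R0 /=; apply: within_now; left; eexists; exists M.
by split; [by [] | by split | by [] | rewrite /= addn1].
Qed.

Lemma print_exit S st : print_inv S n st -> run 1 st (printed S).
Proof.
move=> [R [M [-> [R0 R1 R2 R3 R5] mk R7]]].
tick; rewrite R7 R3 eqxx; apply: within_now; split=> //=.
rewrite -val_enum_ord filter_map {2}/enum_mem -enumT; congr map.
by apply: eq_filter => v /=; rewrite mk.2 eqb1.
Qed.

Lemma knapsack_start :
  run 8 (init (encode l k)) (fun st => seed_inv 0 st \/ seeded st).
Proof.
have b3 := base_ge3; have mk := marks0.
rewrite /init; set M := nth 0 (encode l k) in mk *.
have M0 : M 0 = n by [].
have M1 : M 1 = k by [].
tick; rewrite modn_small; last by lia.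
tick; rewrite modn_small; last by lia.
tick; rewrite M0.
tick; rewrite M1.
tick; rewrite add_small; last by lia.
tick; rewrite (addnC _ 2) (marks_ptr mk) // -/base.
tick; case: ltnP => k2.
  apply: within_now; left; split=> //; first by move=> v; rewrite below0 inE.
  by eexists; exists M; split; [by [] | by split | by [] | by [] | by []].
(* For [k <= 2] the search for a seed is skipped, and the degree condition of [greedy_init] is
   vacuous. *)
tick; apply: within_now; right; exists set0, None; split.
  by apply: greedy_init => k2'; lia.
by eexists; exists M; split; [by [] | by split | by [] | rewrite /= cards0 subn0 | by []].
Qed.

(** A failed search has seen that all degrees are at most 1, as [greedy_init] requires. *)
Lemma seed_exit st : seed_inv n st -> run 1 st seeded.
Proof.
case=> k2 deg1 [R [M [-> [R0 R1 R2 R3 R5] mk R4 [R6 R7]]]].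
tick; rewrite R7 R3 eqxx; apply: within_now; exists set0, None; split.
  by apply: greedy_init => _ v; apply: deg1; rewrite below_all inE.
by exists R, M; split; rewrite // cards0 subn0.
Qed.

Lemma seeded_scan st : seeded st -> run 1 st (scan_inv 0).
Proof.
case=> S [s [inv [R [M [-> [R0 R1 R2 R3 R5] mk R4 R6]]]]].
tick; rewrite mod0n; apply: within_now; exists S, s; eexists; exists M.
by split; [rewrite below0 | by [] | by split | by [] | by split].
Qed.

Lemma scan_exit st : scan_inv n st -> run 1 st chosen.
Proof.
case=> S [s [R [M [inv -> [R0 R1 R2 R3 R5] mk [R4 R6 R7]]]]].
tick; rewrite R7 R3 eqxx; apply: within_now; exists S, R, M; split=> //.
by apply: (greedy_optimal inv); right; rewrite below_all.
Qed.

Lemma chosen_print st :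
  chosen st -> run 1 st (fun st' => exists2 S, optimal G k S & print_inv S 0 st').
Proof.
case=> S [R [M [opt -> [R0 R1 R2 R3 R5] mk]]].
tick; rewrite mod0n; apply: within_now; exists S => //; eexists; exists M.
by split; [by [] | by split | by [] | by []].
Qed.

Lemma knapsack_correct :
  run (60 * n.+1) (init (encode l k))
    (fun st => exists2 S, optimal G k S & printed S st).
Proof.
(* The start, then the seed, scan and print loops, with one step for each exit and each counter
   reset; the total is [57 * n + 13]. *)
pose T := 8 + (20 * n + 1 + (1 + (30 * n + 1 + (1 + (7 * n + 1))))).
apply: (@within_leq _ _ T); first by rewrite /T; lia.
apply: within_bind knapsack_start _ => st st0.
apply: (within_bind (Q1 := seeded)) => [|st1 sd].
  case: st0 => [st0|]; last exact: within_now.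
  exact: within_loop seed_body seed_exit st st0.
apply: within_bind (seeded_scan sd) _ => st2 sc.
apply: within_bind (within_loop scan_body scan_exit sc) _ => st3 ch.
apply: within_bind (chosen_print ch) _ => st4 [S opt pr].
apply: within_imp (leqnn _) (within_loop (@print_body S) (@print_exit S) pr) _.
by move=> st5; exists S.
Qed.
End Knapsack.

Theorem theorem6 :
  exists (P : program) (C : nat),
    forall (n : nat) (G : sgraph 'I_n) (l : 'I_n -> seq 'I_n) (k w : nat),
      adjacency_lists G l ->
      0 < k ->
      k < 2 ^ w ->
      C * (n + #|edges G|).+1 <= 2 ^ w ->
      exists (U : {set 'I_n}) (o : seq nat),
        [/\ optimal G k U,
            perm_eq o [seq val v | v <- enum U]
          & computes_within w P (encode l k) (C * (n + #|edges G|).+1) o].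
Proof.
(* The constant bounds the time, and also makes words large enough to address the input and the
   marks, at most [2 * n + 3 + 2 * #|edges G|] cells. *)
exists knapsack, 60 => n G l k w l_adj k_gt0 k_fits C_fits.
have deg2 : sumn (degs l) <= 2 * #|edges G|.
  rewrite sumn_degs (leq_trans _ (sum_degrees_le G)) // leq_sum // => v _.
  by rewrite (size_nbrs l_adj).
have memory_fits : ptr l n + n < 2 ^ w.
  by rewrite /ptr take_oversize ?size_degs //; lia.
have [t le_t [S opt [halt outE]]] :=
  knapsack_correct l_adj k_fits memory_fits.
exists S, [seq val v | v <- enum S]; split=> //.
by exists t; split=> //; apply: leq_trans le_t _; lia.
Qed.
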